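(* Let $C_{(\leq,<)}(x,y)$ be the bivariate generating function of the Catalan words avoiding the ordered pair of relations $(\leq,<)$, where $x$ marks the length and $y$ marks the number of descents. Then $$C_{(\leq,<)}(x,y)=\frac{1 + x^2 - x^2y}{1 - x - x^2y}.$$
   Context: A Catalan word of length $n$ is a word $w=w_1w_2\cdots w_n$ over the non-negative integers with $w_1=0$ and $0\leq w_i\leq w_{i-1}+1$ for $i=2,\dots,n$; the empty word is the unique Catalan word of length $0$. For relations $X,Y\in\{<,>,\leq,\geq,=,\neq\}$, a word $w$ contains the pattern $(X,Y)$ if there is an index $i\geq 1$ (with $i+2\le n$) such that $w_i\,X\,w_{i+1}$ and $w_{i+1}\,Y\,w_{i+2}$; otherwise $w$ avoids $(X,Y)$. The number of descents $\mathrm{des}(w)$ is the number of indices $i$ with $w_i>w_{i+1}$. The bivariate generating function is $C_{(X,Y)}(x,y)=\sum_{w}x^{|w|}y^{\mathrm{des}(w)}$, the sum being over all Catalan words $w$ (of any length $|w|\geq 0$) avoiding $(X,Y)$. Identities are between formal power series in $x$ with coefficients polynomials in $y$. *)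

(* Defs.v *)
From HB Require Import structures.
From mathcomp Require Import all_boot all_algebra.
From mathcomp Require Import boolp.

Set Implicit Arguments.
Unset Strict Implicit.
Unset Printing Implicit Defensive.

Import GRing.Theory.
Local Open Scope ring_scope.

(* Formal power series in one variable, as a ring under the Cauchy product.   *)

Record fps (R : Type) := Fps { fcoef : nat -> R }.

HB.instance Definition _ (R : Type) := gen_eqMixin (fps R).
HB.instance Definition _ (R : Type) := gen_choiceMixin (fps R).

Lemma fpsP (R : Type) (f g : fps R) : fcoef f =1 fcoef g -> f = g.
Proof. by case: f g => [f] [g] /= /funext ->. Qed.

Section FpsRing.
Variable R : comNzRingType.
Implicit Types f g h : fps R.

Definition fps_add f g := Fps (fun n => fcoef f n + fcoef g n).
Definition fps_opp f := Fps (fun n => - fcoef f n).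
Definition fpsC (c : R) : fps R := Fps (fun n => c *+ (n == 0)%N).
Definition fpsX : fps R := Fps (fun n => (n == 1)%:R).
Definition fps_mul f g :=
  Fps (fun n => \sum_(i < n.+1) fcoef f i * fcoef g (n - i)).

Fact fps_addA : associative fps_add.
Proof. by move=> f g h; apply: fpsP => n /=; rewrite addrA. Qed.
Fact fps_addC : commutative fps_add.
Proof. by move=> f g; apply: fpsP => n /=; rewrite addrC. Qed.
Fact fps_add0 : left_id (fpsC 0) fps_add.
Proof. by move=> f; apply: fpsP => n /=; rewrite mul0rn add0r. Qed.
Fact fps_addN : left_inverse (fpsC 0) fps_opp fps_add.
Proof. by move=> f; apply: fpsP => n /=; rewrite mul0rn addNr. Qed.

HB.instance Definition _ :=
  GRing.isZmodule.Build (fps R) fps_addA fps_addC fps_add0 fps_addN.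

Let trunc m f := \poly_(i < m) fcoef f i.

Let trunc_mul m f g n : (n < m)%N ->
  fcoef (fps_mul f g) n = (trunc m f * trunc m g)`_n.
Proof.
move=> nm; rewrite coefM; apply: eq_bigr => i _; rewrite !coef_poly.
by rewrite (leq_trans (ltn_ord i)) // (leq_ltn_trans (leq_subr _ _)).
Qed.

Fact fps_mulA : associative fps_mul.
Proof.
move=> f g h; apply: fpsP => n.
transitivity ((trunc n.+1 f * (trunc n.+1 g * trunc n.+1 h))`_n).
  rewrite coefM; apply: eq_bigr => i _; rewrite coef_poly ltn_ord.
  by rewrite -trunc_mul // ltnS leq_subr.
rewrite mulrA coefM; apply: eq_bigr => i _.
by rewrite -trunc_mul // coef_poly ltnS leq_subr.
Qed.
Fact fps_mulC : commutative fps_mul.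
Proof.
move=> f g; apply: fpsP => n.
by rewrite !(@trunc_mul n.+1) // mulrC.
Qed.
Fact fps_mul1 : left_id (fpsC 1) fps_mul.
Proof.
move=> f; apply: fpsP => n /=; rewrite big_ord_recl /= mul1r subn0.
by rewrite big1 ?addr0 // => i _; rewrite mul0r.
Qed.
Fact fps_mulDl : left_distributive fps_mul fps_add.
Proof.
move=> f g h; apply: fpsP => n /=; rewrite -big_split /=.
by apply: eq_bigr => i _; rewrite mulrDl.
Qed.
Fact fps_1_neq0 : fpsC 1 != fpsC 0.
Proof.
by apply/eqP => /(congr1 (fun f => fcoef f 0)) /= /eqP; rewrite oner_eq0.
Qed.

HB.instance Definition _ := GRing.Zmodule_isComNzRing.Build (fps R)
  fps_mulA fps_mulC fps_mul1 fps_mulDl fps_1_neq0.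

Lemma fcoef0 n : fcoef (0 : fps R) n = 0.
Proof. exact: mul0rn. Qed.
Lemma fcoef1 n : fcoef (1 : fps R) n = (n == 0)%:R.
Proof. by []. Qed.
Lemma fcoefD f g n : fcoef (f + g) n = fcoef f n + fcoef g n.
Proof. by []. Qed.
Lemma fcoefN f n : fcoef (- f) n = - fcoef f n.
Proof. by []. Qed.
Lemma fcoefM f g n :
  fcoef (f * g) n = \sum_(i < n.+1) fcoef f i * fcoef g (n - i).
Proof. by []. Qed.

End FpsRing.

Arguments fpsX {R}.

Section FpsUnit.
Variable R : comUnitRingType.
Implicit Types f g : fps R.

Definition fps_unit : pred (fps R) := [pred f | fcoef f 0 \is a GRing.unit].

(* fps_inv_seq f n lists the first n + 1 coefficients of the inverse g of f,  *)
(* from g_0 = f_0^-1 and g_n = - f_0^-1 * \sum_(i < n) f_(n - i) * g_i.       *)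
Fixpoint fps_inv_seq f n : seq R :=
  if n is m.+1 then
    let s := fps_inv_seq f m in
    rcons s (- (fcoef f 0)^-1 * \sum_(i < n) fcoef f (n - i) * s`_i)
  else [:: (fcoef f 0)^-1].

(* Non-units are fixed, as GRing.ComNzRing_hasMulInverse requires.            *)
Definition fps_inv f :=
  if fps_unit f then Fps (fun n => (fps_inv_seq f n)`_n) else f.

Let size_inv_seq f n : size (fps_inv_seq f n) = n.+1.
Proof. by elim: n => //= n IH; rewrite size_rcons IH. Qed.

Let nth_inv_seq f m n : (n <= m)%N ->
  (fps_inv_seq f m)`_n = (fps_inv_seq f n)`_n.
Proof.
elim: m => [|m IH]; first by rewrite leqn0 => /eqP ->.
rewrite leq_eqVlt => /predU1P [-> //|nm] /=.
by rewrite nth_rcons size_inv_seq nm IH.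
Qed.

Fact fps_mulV : {in fps_unit, left_inverse 1 fps_inv *%R}.
Proof.
move=> f fU; have f0U : fcoef f 0 \is a GRing.unit by [].
rewrite mulrC /fps_inv ifT //.
apply: fpsP => -[|n]; rewrite fcoefM fcoef1.
  by rewrite big_ord1 /= divrr.
rewrite big_ord_recl /= subn0 nth_rcons size_inv_seq ltnn eqxx.
rewrite mulNr mulrN mulrA divrr ?mul1r; last by [].
rewrite [X in - X](reindex_inj rev_ord_inj) /= -sumrN -big_split big1 //= => i _.
rewrite subKn // /bump /= add1n subSS.
by rewrite (@nth_inv_seq f n) ?leq_subr // addNr.
Qed.

Fact fps_unitPl f g : g * f = 1 -> fps_unit f.
Proof.
move=> /(congr1 (fun h => fcoef h 0)); rewrite fcoefM big_ord1 fcoef1 => fg.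
by apply/unitrPr; exists (fcoef g 0); rewrite mulrC.
Qed.

Fact fps_inv_out : {in [predC fps_unit], fps_inv =1 id}.
Proof. by move=> f /negbTE fU; rewrite /fps_inv ifF. Qed.

HB.instance Definition _ := GRing.ComNzRing_hasMulInverse.Build (fps R)
  fps_mulV fps_unitPl fps_inv_out.

Lemma fps_unitE f : (f \is a GRing.unit) = (fcoef f 0 \is a GRing.unit).
Proof. by []. Qed.

End FpsUnit.

(* The letters w_1, ..., w_n of a word w are indexed from 0 by nth.           *)

Definition catalan (w : seq nat) : bool :=
  (head 0 w == 0)%N && sorted (fun a b => b <= a.+1)%N w.

Definition contains (X Y : rel nat) (w : seq nat) : bool :=
  has (fun i => X (nth 0%N w i) (nth 0%N w i.+1)
                && Y (nth 0%N w i.+1) (nth 0%N w i.+2))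
      (iota 0 (size w - 2)).

Definition avoids (X Y : rel nat) (w : seq nat) : bool := ~~ contains X Y w.

Definition des (w : seq nat) : nat :=
  count (fun i => nth 0%N w i > nth 0%N w i.+1)%N (iota 0 (size w).-1).

(* The letters of a Catalan word of length n are smaller than n, so that the  *)
(* sum over n.-tuple 'I_n below ranges over all Catalan words of length n.    *)
Lemma catalan_ltn_size (w : seq nat) :
  catalan w -> all (fun a => a < size w)%N w.
Proof.
case: w => [//|a w] /andP [/= /eqP -> wP].
suff H m : path (fun a b => b <= a.+1)%N m w ->
    all (fun b => b <= m + size w)%N w by exact: (H 0%N).
elim: w m {wP} => [//|b w IH] m /= /andP [bm /IH wP].
rewrite addnS (leq_trans bm) ?ltnS ?leq_addr //=.
by apply: sub_all wP => c /leq_trans; apply; rewrite -addSn leq_add2r.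
Qed.

(* x is fpsX and y is the variable of {poly int}.                             *)
Definition catalan_gf (X Y : rel nat) : fps {poly int} :=
  Fps (fun n => \sum_(w : n.-tuple 'I_n |
                      catalan (map val w) && avoids X Y (map val w))
                  'X^(des (map val w))).

(* Main.v *)
(* In an avoiding word an ascent can only occur at the very beginning or right
   after a descent. Hence the second letter decides: after 00 the word is
   constant, and a word 01u with u nonempty is either 011v, where one 1 may be
   deleted, or 010v, where deleting 01 removes one descent and leaves an
   arbitrary avoiding word 0v. This gives c_(n+3) = c_(n+2) + y c_(n+1) for the
   coefficients c_n of x^n. *)

Require Import Defs.
From mathcomp Require Import all_boot all_algebra.
From mathcomp Require Import ring.

Import GRing.Theory.
Local Open Scope ring_scope.

Section FpsCoefficients.
Variable R : comNzRingType.
Implicit Types (c : R) (f : fps R).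

Lemma fcoefCM c f n : fcoef (fpsC c * f) n = c * fcoef f n.
Proof.
rewrite fcoefM big_ord_recl /= subn0 big1 ?addr0 // => i _.
by rewrite mulr0n mul0r.
Qed.

Lemma fcoefXM0 f : fcoef (fpsX * f) 0 = 0.
Proof. by rewrite fcoefM big_ord1 /= mul0r. Qed.

Lemma fcoefXMS f n : fcoef (fpsX * f) n.+1 = fcoef f n.
Proof.
rewrite fcoefM 2!big_ord_recl big1 => [|i _] /=; last by rewrite mul0r.
by rewrite mul0r mul1r add0r addr0 subn1.
Qed.

End FpsCoefficients.

(** Passes to a sum over an explicit list: letters below the length make each word of length [n]
    satisfying [P] the image of exactly one tuple. *)
Lemma big_tuple_ord (V : nmodType) n (P : pred (seq nat)) (F : seq nat -> V)
    (s : seq (seq nat)) :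
    (forall w, P w -> all (fun a => a < size w)%N w) ->
    uniq s -> (forall w, (w \in s) = (size w == n) && P w) ->
  \sum_(w : n.-tuple 'I_n | P (map val w)) F (map val w) = \sum_(w <- s) F w.
Proof.
move=> Plt s_uniq sP.
have val_inj2 : injective (fun t : n.-tuple 'I_n => map val t).
  by move=> t u /(inj_map val_inj) /val_inj.
rewrite -big_filter.
rewrite -(big_map (fun t : n.-tuple 'I_n => map val t) xpredT F).
apply: perm_big; apply: uniq_perm => //.
  by rewrite map_inj_uniq // filter_uniq // index_enum_uniq.
move=> w; rewrite sP; apply/mapP/andP => [[t]|[/eqP sw Pw]].
  by rewrite mem_filter => /andP [Pt _] ->; rewrite size_map size_tuple eqxx.
have wlt : all (fun a => a < n)%N w by rewrite -sw Plt.
(* [insub] succeeds on every letter, so [pmap] drops none. *)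
have Ew : map val (pmap (insub : nat -> option 'I_n) w) = w.
  by rewrite (pmap_filter (insubK _)); apply/all_filterP;
    apply: sub_all wlt => a alt; rewrite isSome_insub.
have St : size (pmap (insub : nat -> option 'I_n) w) == n.
  by rewrite -(size_map val) Ew sw.
by exists (Tuple St); rewrite ?mem_filter /= ?Ew ?Pw ?mem_index_enum.
Qed.

Lemma contains_cons3 X Y a b c w :
  contains X Y [:: a, b, c & w] = X a b && Y b c || contains X Y [:: b, c & w].
Proof.
rewrite /contains /= !subSS !subn0 /=; congr (_ || _).
by rewrite (iotaDl 1 0) has_map.
Qed.

Lemma des_cons2 a b w : des [:: a, b & w] = ((b < a) + des (b :: w))%N.
Proof.
by rewrite /des /= (iotaDl 1 0) count_map.
Qed.

(** The preceding letter [a] is arbitrary, so that the condition passes to suffixes. *)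
Definition avoiding_tail (a : nat) (w : seq nat) : bool :=
  path (fun a b => b <= a.+1)%N a w && avoids leq ltn (a :: w).

Lemma avoiding_tail_cons2 a b c w :
  avoiding_tail a [:: b, c & w] =
  [&& b <= a.+1, ~~ (a <= b < c) & avoiding_tail b (c :: w)]%N.
Proof.
rewrite /avoiding_tail /avoids contains_cons3 negb_or /= -andbA.
by congr (_ && _); apply: andbCA.
Qed.

Lemma avoiding_tail1 a b : avoiding_tail a [:: b] = (b <= a.+1)%N.
Proof. by rewrite /avoiding_tail /= !andbT. Qed.

(** A weak ascent forbids a rise at the next step, and a 0 that cannot be followed by a rise is
    followed by 0. *)
Lemma avoiding_tail00 w :
  avoiding_tail 0 (0%N :: w) = (w == nseq (size w) 0%N).
Proof.
elim: w => [|c w IH] //; rewrite avoiding_tail_cons2 /= eqseq_cons.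
by case: c => [|c] //=; rewrite IH.
Qed.

(** The descent from 1 to 0 lifts every restriction on what follows the 0. *)
Lemma avoiding_tail010 w :
  avoiding_tail 0 [:: 1, 0 & w]%N = avoiding_tail 0 w.
Proof.
rewrite avoiding_tail_cons2 /=.
by case: w => [|c w]; rewrite ?avoiding_tail_cons2.
Qed.

(** After 0 or after 1, the letter 1 ends a weak ascent, so the same letters may follow it. *)
Lemma avoiding_tail011 w :
  avoiding_tail 0 [:: 1, 1 & w]%N = avoiding_tail 0 (1%N :: w).
Proof.
rewrite avoiding_tail_cons2 /=; case: w => [|c w] //.
by rewrite !avoiding_tail_cons2 /=; case: c => [|[|c]].
Qed.

Lemma avoiding_tail01_gt1 c w : avoiding_tail 0 [:: 1, c.+2 & w]%N = false.
Proof. by rewrite avoiding_tail_cons2. Qed.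

Lemma avoiding_tail0_gt1 c w : avoiding_tail 0 (c.+2 :: w) = false.
Proof. by case: w => [|b w]; rewrite ?avoiding_tail1 ?avoiding_tail_cons2. Qed.

Lemma catalan_avoids_cons a w :
  catalan (a :: w) && avoids leq ltn (a :: w) = (a == 0)%N && avoiding_tail 0 w.
Proof. by rewrite /catalan -andbA /=; case: eqP => // ->. Qed.

(* [tails01 n] and [tails0 n] list the words [u] of length [n] such that [01u],
   respectively [0u], is a Catalan word avoiding the pattern. *)
Fixpoint tails01 (n : nat) : seq (seq nat) :=
  if n is m.+1 then
    map (cons 1%N) (tails01 m) ++
    map (cons 0%N) (if m is k.+1 then nseq m 0%N :: map (cons 1%N) (tails01 k)
                    else [:: [::]])
  else [:: [::]].

Definition tails0 (n : nat) : seq (seq nat) :=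
  if n is m.+1 then nseq n 0%N :: map (cons 1%N) (tails01 m) else [:: [::]].

(** The inner [match] of [tails01] is [tails0] written out, which turns a mutual recursion into a
    structural one. *)
Lemma tails01S n :
  tails01 n.+1 = map (cons 1%N) (tails01 n) ++ map (cons 0%N) (tails0 n).
Proof. by case: n. Qed.

Lemma mem_map_cons (T : eqType) (a b : T) (w : seq T) (s : seq (seq T)) :
  (b :: w \in map (cons a) s) = (b == a) && (w \in s).
Proof.
by apply/mapP/andP => [[u us [-> ->]]|[/eqP -> ws]]; [rewrite eqxx | exists w].
Qed.

Lemma nil_map_cons (T : eqType) (a : T) (s : seq (seq T)) :
  ([::] \in map (cons a) s) = false.
Proof. by apply/mapP => -[]. Qed.

(** A joint induction, as the lists are mutually recursive; the cases are a first letter 0, 1 or at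
    least 2, the last being impossible. *)
Lemma mem_tails n :
  (forall w, (w \in tails01 n) = (size w == n) && avoiding_tail 0 (1%N :: w)) /\
  (forall w, (w \in tails0 n) = (size w == n) && avoiding_tail 0 w).
Proof.
elim: n => [|n [IH1 IH0]]; first by split=> -[].
split=> -[|c w]; rewrite ?tails01S ?mem_cat ?inE ?nil_map_cons //.
  rewrite !mem_map_cons IH1 IH0 /= eqSS.
  case: c => [|[|c]] /=; rewrite ?orbF.
  - by rewrite avoiding_tail010.
  - by rewrite avoiding_tail011.
  - by rewrite avoiding_tail01_gt1 andbF.
rewrite mem_map_cons IH1 /= eqSS eqseq_cons.
case: c => [|[|c]] //=.
- rewrite orbF avoiding_tail00; apply/eqP/andP => [->|[/eqP <- /eqP //]].
  by rewrite size_nseq !eqxx.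
- by rewrite avoiding_tail0_gt1 andbF.
Qed.

Lemma tails_uniq n : uniq (tails01 n) /\ uniq (tails0 n).
Proof.
have cons_inj (a : nat) : injective (cons a) by move=> u v [].
elim: n => [|n [IH1 IH0]] //; split; rewrite ?tails01S.
  rewrite cat_uniq !map_inj_uniq // IH1 IH0 andbT /=.
  by apply/hasPn => _ /mapP [u _ ->]; rewrite mem_map_cons.
by rewrite /= mem_map_cons map_inj_uniq.
Qed.

(** Indexed by the length of the tail: the whole words have length [n + 2] here and [n + 1] in
    [gf_tails0]. *)
Definition gf_tails01 (n : nat) : {poly int} :=
  \sum_(u <- tails01 n) 'X^(des [:: 0, 1 & u]%N).
Definition gf_tails0 (n : nat) : {poly int} :=
  \sum_(u <- tails0 n) 'X^(des (0%N :: u)).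

Lemma gf_tails01_0 : gf_tails01 0 = 1.
Proof. exact: big_seq1. Qed.

Lemma gf_tails0_0 : gf_tails0 0 = 1.
Proof. exact: big_seq1. Qed.

(** A repeated 1 adds no descent; returning to 0 adds one, whence the factor ['X]. *)
Lemma gf_tails01S n : gf_tails01 n.+1 = gf_tails01 n + 'X * gf_tails0 n.
Proof.
rewrite /gf_tails01 tails01S big_cat !big_map mulr_sumr; congr (_ + _).
  by apply: eq_bigr => u _; rewrite !des_cons2.
by apply: eq_bigr => u _; rewrite !des_cons2 /= add0n add1n exprS.
Qed.

Lemma des_nseq0 n : des (nseq n 0%N) = 0%N.
Proof. by case: n => // n; elim: n => //= n IH; rewrite des_cons2 IH. Qed.

Lemma gf_tails0S n : gf_tails0 n.+1 = 1 + gf_tails01 n.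
Proof.
by rewrite /gf_tails0 big_cons big_map (des_nseq0 n.+2) expr0.
Qed.

Lemma catalan_gf0 : fcoef (catalan_gf leq ltn) 0 = 1.
Proof.
rewrite /= (@big_tuple_ord _ 0 (fun w => catalan w && avoids leq ltn w)
  (fun w => 'X^(des w)) [:: [::]]) ?big_seq1 //; last by case.
by move=> w /andP [/catalan_ltn_size].
Qed.

Lemma catalan_gfS n : fcoef (catalan_gf leq ltn) n.+1 = gf_tails0 n.
Proof.
rewrite /= (@big_tuple_ord _ n.+1 (fun w => catalan w && avoids leq ltn w)
  (fun w => 'X^(des w)) (map (cons 0%N) (tails0 n))) ?big_map //.
- by move=> w /andP [/catalan_ltn_size].
- by rewrite map_inj_uniq ?(proj2 (tails_uniq n)) // => u v [].
move=> [|a w]; first by rewrite nil_map_cons.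
rewrite mem_map_cons catalan_avoids_cons (proj2 (mem_tails n)) /= eqSS.
exact: andbCA.
Qed.

Theorem theorem3p19 :
  let x : fps {poly int} := fpsX in
  let y : fps {poly int} := fpsC 'X in
  catalan_gf leq ltn = (1 + x ^+ 2 - x ^+ 2 * y) / (1 - x - x ^+ 2 * y).
Proof.
move=> x y; set G := catalan_gf leq ltn.
have U : 1 - x - x ^+ 2 * y \is a GRing.unit.
  rewrite fps_unitE -[_ * y]mulrA !fcoefD !fcoefN fcoef1 fcoefXM0.
  by rewrite /= !subr0 unitr1.
apply: (canRL (mulrK U)).
(* Nesting the products lets coefficients be read off by shifts; the factors [1] below serve the
   same end. *)
have -> : G * (1 - x - x ^+ 2 * y) = G - x * G - x * (x * (y * G)) by ring.
have -> : 1 + x ^+ 2 - x ^+ 2 * y = 1 + x * (x * 1) - x * (x * (y * 1)) by ring.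
apply: fpsP => -[|[|[|n]]]; rewrite !(fcoefD, fcoefN) ?fcoefXMS ?fcoefXM0
  ?fcoefXMS ?fcoefXM0 ?fcoefCM ?fcoef1 ?catalan_gf0 ?catalan_gfS.
- by rewrite !subr0 addr0.
- by rewrite gf_tails0_0 subrr addr0.
- by rewrite gf_tails0S gf_tails01_0 gf_tails0_0 /= add0r addrK.
(* From degree 3 on the numerator vanishes, and the contributions 1 of the constant words cancel. *)
- rewrite !gf_tails0S gf_tails01S /=; ring.
Qed.
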